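(* Let $n\ge3$ and $r\ge1$ be integers. Every nonzero eigenvalue of $A_{n,r}$ is simple (i.e. of algebraic multiplicity one).
   Context: For integers $n\ge3$ and $r\ge1$, the digraph $\Gamma_{n,r}$ has vertex set $V(\Gamma_{n,r})=\{1,2,\dots,rn-2r+2\}$ and directed edge set $E(\Gamma_{n,r})$ defined by $E(\Gamma_{n,1})=\{(j,j+1):1\le j\le n-1\}\cup\{(n,1)\}$; $E(\Gamma_{n,2})=E(\Gamma_{n,1})\cup\{(1,n+1)\}\cup\{(j,j+1):n+1\le j\le 2n-3\}\cup\{(2n-2,n)\}$; and for $r\ge3$, $E(\Gamma_{n,r})=E(\Gamma_{n,2})\cup\bigcup_{i=1}^{r-2}F_i$, where $F_i=\{(in-2i+2,\,in+n-2i+1)\}\cup\{(j,j+1):in+n-2i+1\le j\le in+2n-2i-3\}\cup\{(in+2n-2i-2,\,in+n-2i)\}$. (For $n=3$ the middle path parts are empty.) The adjacency matrix $A_{n,r}$ is the $(0,1)$-matrix indexed by $V(\Gamma_{n,r})$ whose $(u,v)$-entry is $1$ if and only if $(u,v)\in E(\Gamma_{n,r})$. Eigenvalues are complex. *)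

(* Defs.v *)
From mathcomp Require Import all_boot all_order all_algebra.
From mathcomp Require Import reals complex.

Set Implicit Arguments.
Unset Strict Implicit.
Unset Printing Implicit Defensive.

Import GRing.Theory.

Local Open Scope nat_scope.

(* Truncated subtraction below never truncates when 2 < n and 0 < r (or 0 < i):
   all differences are those of the integers. *)

Definition nvertices (n r : nat) : nat := r * n - 2 * r + 2.

Definition Gamma1 (n : nat) : rel nat := fun u v =>
  [&& 1 <= u, u <= n - 1 & v == u + 1] || ((u, v) == (n, 1)).

Definition Gamma2 (n : nat) : rel nat := fun u v =>
  [|| Gamma1 n u v,
      (u, v) == (1, n + 1),
      [&& n + 1 <= u, u <= 2 * n - 3 & v == u + 1] |
      (u, v) == (2 * n - 2, n)].

Definition Fedges (n i : nat) : rel nat := fun u v =>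
  [|| (u, v) == (i * n - 2 * i + 2, i * n + n - 2 * i + 1),
      [&& i * n + n - 2 * i + 1 <= u, u <= i * n + 2 * n - 2 * i - 3
        & v == u + 1] |
      (u, v) == (i * n + 2 * n - 2 * i - 2, i * n + n - 2 * i)].

(* The value at r = 0 is irrelevant. For r = 2 the list iota 1 (r - 2) of the
   i with 1 <= i <= r - 2 is empty. *)
Definition Gamma (n r : nat) : rel nat := fun u v =>
  if r <= 1 then Gamma1 n u v
  else Gamma2 n u v || has (fun i => Fedges n i u v) (iota 1 (r - 2)).

Local Open Scope ring_scope.

(* The ordinal u : 'I_(nvertices n r) stands for the vertex u.+1. *)
Definition adjacency (K : pzRingType) (n r : nat) : 'M[K]_(nvertices n r) :=
  \matrix_(u, v) (Gamma n r u.+1 v.+1)%:R.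

(* Main.v *)
Require Import Defs.
From mathcomp Require Import all_boot all_order all_algebra.
From mathcomp Require Import reals complex.
From mathcomp Require Import zify ring.

(** Put d = n - 2. The graph consists of hubs a_0, ..., a_r joined by the edges
    from a_k to a_(k-1), by paths of d edges from a_k to a_(k+2), and by one path
    of d + 1 edges from the root a_0 to a_1.

    Eliminating the inner vertices of the paths from (X - A) x = 0 leaves a
    three-step recurrence between the values at the hubs, counted down from
    a_r: P_(j+3) = X^d P_(j+2) - X^(2d-2) P_j, with P_0 = P_1 = 0 and P_2 = 1.
    The resulting vector [test_vec] solves every equation of (X - A) x = 0 but
    that of the root, where the defect is P_(r+4) up to a power of X. Cramer's
    rule turns this into

      char_poly A * X^m = (one cofactor of X - A) * P_(r+4),

    and the cofactor has no nonzero root: for z <> 0 the same elimination shows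
    that a solution which vanishes at a_r is zero ([char_poly_cofactor]). So it
    is enough that P_(r+4) has no multiple nonzero root.

    In the variable w = z^-(d+2) the recurrence becomes
    q_(j+3) = q_(j+2) - w q_j, which no longer depends on d; the values of P_j
    and q_j, and those of their derivatives, determine each other
    ([horner_hub_poly]). The roots of the polynomials q_j are real, and those
    of consecutive ones interlace. This is expressed by the Bezoutian

      B_j(w, v) = (q_j(w) q_(j+1)(v) - q_(j+1)(w) q_j(v)) / (w - v),

    which, together with two companions, satisfies a recurrence whose
    coefficients are 1, w v and the products q_i(w) q_i(v). It is thus positive
    when w v > 0 and these products are nonnegative ([bezoutian_rec_gt0]).
    Taking v to be the conjugate of w shows that q_(j+1) has no nonreal root;
    letting v tend to w, which makes B_j a Wronskian, shows that a real root is
    simple ([root_delayed_simple]). *)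

Set Implicit Arguments.
Unset Strict Implicit.
Unset Printing Implicit Defensive.

Import Order.TTheory GRing.Theory Num.Theory.

(** * Successors in the graph *)

(** Out-neighbours with vertices numbered from 0 and n = d + 2, for every r at
    once: the graph is the restriction of this infinite one to the first r * d + 2
    vertices. The hubs are a_0 = 0 and a_k = k * d + 1 for k >= 1; note that
    a_0 is not 0 * d + 1, whence the special cases. *)
Definition succs (d i : nat) : seq nat :=
  if i == 0 then [:: 1; d + 2]
  else if (1 < i) && (d %| i - 1) then
    [:: if i == d + 1 then 0 else i - d; i + d + 1]
  else [:: i + 1].

Lemma succs_hub d k : 0 < d -> 0 < k ->
  succs d (k * d + 1) =
    [:: if k == 1 then 0 else (k - 1) * d + 1; (k + 1) * d + 2].
Proof.
move=> d_gt0 k_gt0; have kd_gt0 : 0 < k * d by rewrite muln_gt0 k_gt0.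
rewrite /succs addn_eq0 andbF ifT; last first.
  by rewrite addnK dvdn_mull // andbT addn1 ltnS.
rewrite eqn_add2r -{2}(mul1n d) eqn_pmul2r //; congr [:: _; _]; last by lia.
by case: eqP => // _; rewrite mulnBl -addnBAC ?mul1n // leq_pmull.
Qed.

Lemma succs_path d i : 0 < i -> (forall k, 0 < k -> i <> k * d + 1) ->
  succs d i = [:: i + 1].
Proof.
move=> i_gt0 i_nhub; rewrite /succs ifF; last by lia.
rewrite ifF //; apply/negP=> /andP[i_gt1 /dvdnP[k iE]].
by apply: (i_nhub k); [case: k iE => //; lia | lia].
Qed.

Variant succs_spec d i : seq nat -> Prop :=
| SuccsRoot of i = 0 : succs_spec d i [:: 1; d + 2]
| SuccsHub k of 0 < k & i = k * d + 1 : succs_spec d i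
    [:: if k == 1 then 0 else (k - 1) * d + 1; (k + 1) * d + 2]
| SuccsPath of 0 < i & (forall k, 0 < k -> i <> k * d + 1) :
    succs_spec d i [:: i + 1].

Lemma succsP d i : 0 < d -> succs_spec d i (succs d i).
Proof.
move=> d_gt0; case: (posnP i) => [->|i_gt0]; first by constructor 1.
have [/andP[i_gt1 /dvdnP[k iE]]|nhub] := boolP ((1 < i) && (d %| i - 1)).
  have k_gt0 : 0 < k by case: k iE => //; lia.
  have {}iE : i = k * d + 1 by lia.
  by rewrite iE succs_hub //; apply: SuccsHub.
have i_nhub k : 0 < k -> i <> k * d + 1.
  move=> k_gt0 iE; case/negP: nhub; rewrite iE addnK dvdn_mull // andbT addn1.
  by rewrite ltnS muln_gt0 k_gt0.
by rewrite succs_path //; constructor 3.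
Qed.

(** The definition of the edges treats r <= 1, r = 2 and r >= 3 separately; here
    the second cycle becomes the case k = 0 of the family of cycles added later,
    but for its initial vertex, which is the root. *)
Lemma GammaP d r i j : 0 < r ->
  Gamma (d + 2) r i.+1 j.+1 <->
  [\/ i <= d /\ j = i + 1, i = d + 1 /\ j = 0
    | exists2 k, k + 2 <= r &
        [\/ i = (if k == 0 then 0 else k * d + 1) /\ j = (k + 1) * d + 2,
            ((k + 1) * d + 2 <= i /\ i <= (k + 2) * d) /\ j = i + 1
          | i = (k + 2) * d + 1 /\ j = (k + 1) * d + 1]].
Proof.
move=> r_gt0.
have G1P : Gamma1 (d + 2) i.+1 j.+1 <->
    (i <= d /\ j = i + 1) \/ (i = d + 1 /\ j = 0).
  by rewrite /Gamma1 !xpair_eqE; lia.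
have G2P : Gamma2 (d + 2) i.+1 j.+1 <-> Gamma1 (d + 2) i.+1 j.+1 \/
   [\/ i = 0 /\ j = d + 2, (d + 2 <= i /\ i <= 2 * d) /\ j = i + 1
          | i = 2 * d + 1 /\ j = d + 1].
  rewrite /Gamma2 !xpair_eqE; case: Gamma1 => /=; first by split=> // _; left.
  split=> [H|[//|]]; last by case=> H; lia.
  right; have : (i = 0 /\ j = d + 2) \/ ((d + 2 <= i /\ i <= 2 * d) /\ j = i + 1)
          \/ (i = 2 * d + 1 /\ j = d + 1) by lia.
  by case=> [|[|]] ?; [constructor 1 | constructor 2 | constructor 3].
have FP k : 0 < k -> Fedges (d + 2) k i.+1 j.+1 <-> 
        [\/ i = k * d + 1 /\ j = (k + 1) * d + 2,
            ((k + 1) * d + 2 <= i /\ i <= (k + 2) * d) /\ j = i + 1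
          | i = (k + 2) * d + 1 /\ j = (k + 1) * d + 1].
  move=> k_gt0; rewrite /Fedges !xpair_eqE !mulnDr !mulnDl mul1n.
  move: (k * d) => kd; split.
    case/or3P=> [/andP[/eqP ? /eqP ?]|/and3P[? ? /eqP ?]|/andP[/eqP ? /eqP ?]];
      [constructor 1 | constructor 2 | constructor 3]; lia.
  by case=> [[? ?]|[[? ?] ?]|[? ?]]; apply/or3P;
    [constructor 1 | constructor 2 | constructor 3]; lia.
rewrite /Gamma; case: (leqP r 1) => [r_le1|r_gt1].
  rewrite G1P; split=> [[?|?]|]; [by constructor 1|by constructor 2|].
  by case=> [?|?|[k k_le]]; [left|right|lia].
split.
  case/orP=> [/G2P[/G1P[?|?]|H]|/hasP[k]]; [by constructor 1|by constructor 2| |].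
    by constructor 3; exists 0 => //=; rewrite !add0n !mul1n.
  rewrite mem_iota => k_iota /FP H; constructor 3; exists k; first by lia.
  have -> : (k == 0) = false by lia.
  by apply: H; lia.
case=> [H|H|[[|k] k_le H]].
- by apply/orP; left; apply/G2P; left; apply/G1P; left.
- by apply/orP; left; apply/G2P; left; apply/G1P; right.
- by apply/orP; left; apply/G2P; right; rewrite !add0n !mul1n in H.
apply/orP; right; apply/hasP; exists k.+1; first by rewrite mem_iota; lia.
by apply/FP.
Qed.

Lemma Gamma_succs d r i j : 0 < d -> 0 < r -> i < r * d + 2 -> j < r * d + 2 ->
  Gamma (d + 2) r i.+1 j.+1 = (j \in succs d i).
Proof.
move=> d_gt0 r_gt0 i_lt j_lt; apply/idP/idP.
  case/GammaP=> // [[i_le ->]|[-> ->]|[k k_le]].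
  - case: (posnP i) => [->|i_gt0]; first by [].
    rewrite succs_path ?inE // => k k_gt0 iE.
    have := leq_pmull d k_gt0; lia.
  - by rewrite -{2}(mul1n d) succs_hub.
  case=> [[-> ->]|[i_bd ->]|[-> ->]].
  - case: k k_le => [|k] k_le; first by rewrite mul1n !inE eqxx orbT.
    by rewrite succs_hub // !inE eqxx orbT.
  - rewrite succs_path ?inE //; first by lia.
    move=> q q_gt0 iE.
    have : k + 1 < q by rewrite -(ltn_pmul2r d_gt0); lia.
    have : q < k + 2 by rewrite -(ltn_pmul2r d_gt0); lia.
    lia.
  by rewrite succs_hub ?addn2 //= !inE /= ?subn1 ?addn1 eqxx.
move=> j_in; apply/GammaP => //; move: j_in.
case: succsP => // [i0|k k_gt0 iE|i_gt0 i_nhub].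
- rewrite !inE => /orP[/eqP->|/eqP jE]; first by constructor 1; lia.
  constructor 3; exists 0; last by constructor 1; rewrite /= mul1n.
  have : 1 < r by rewrite -(ltn_pmul2r d_gt0); lia.
  by lia.
- rewrite !inE => /orP[/eqP|/eqP jE].
    case: eqP => [k1|k_neq1] jE; first by constructor 2; rewrite iE k1 mul1n.
    have kE : k = (k - 2) + 2 by lia.
    constructor 3; exists (k - 2).
      have : k < r + 1 by rewrite -(ltn_pmul2r d_gt0); lia.
      by lia.
    constructor 3; split; first by rewrite iE -kE.
    by rewrite jE; congr (_ * _ + _); lia.
  constructor 3; exists k; last by constructor 1; rewrite ifF //; lia.
  have : k + 1 < r by rewrite -(ltn_pmul2r d_gt0); lia.
  by lia.
rewrite inE => /eqP jE; case: (leqP i d) => [|i_gt]; first by constructor 1.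
have iE := divn_eq (i - 1) d; have s_lt := ltn_pmod (i - 1) d_gt0.
have : 0 < (i - 1) %/ d by rewrite divn_gt0 //; lia.
move: iE s_lt; set k := _ %/ d; set s := _ %% d => iE s_lt k_gt0.
have s_gt0 : 0 < s.
  by case: s iE {s_lt} => // iE; case: (i_nhub k k_gt0); lia.
case: k iE k_gt0 => // k iE _; constructor 3; exists k.
  have : k.+1 < r by rewrite -(ltn_pmul2r d_gt0); lia.
  by lia.
by constructor 2; split=> //; rewrite addn1 addn2 !mulSn; lia.
Qed.

Local Open Scope ring_scope.

Lemma succs_uniq d i : (0 < d)%N -> uniq (succs d i).
Proof.
move=> d_gt0; case: succsP => // [_|k k_gt0 _].
  by rewrite cons_uniq mem_seq1 andbT; apply/eqP; lia.
rewrite cons_uniq mem_seq1 andbT; apply/eqP; case: eqP => _; first by lia.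
by have := leq_mul (leq_subr 1 k) (leqnn d); rewrite mulnDl; lia.
Qed.

(** A function that vanishes beyond the last vertex does not see that [succs]
    leaves the finite graph. *)
Lemma sum_succs (A : pzRingType) d r i (f : nat -> A) :
    (0 < d)%N -> (0 < r)%N -> (i < r * d + 2)%N ->
    (forall j, (r * d + 2 <= j)%N -> f j = 0) ->
  \sum_(j < r * d + 2) (Gamma (d + 2) r i.+1 j.+1)%:R * f j =
    \sum_(j <- succs d i) f j.
Proof.
move=> d_gt0 r_gt0 i_lt f0.
transitivity (\sum_(j < r * d + 2 | val j \in succs d i) f j).
  rewrite [RHS]big_mkcond /=; apply: eq_bigr => j _.
  by rewrite Gamma_succs //; case: ifP => _; rewrite ?mul1r ?mul0r.
rewrite -(big_mkord (fun j => j \in succs d i)) -big_filter.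
rewrite [RHS](bigID (fun j => j < r * d + 2)%N) /=.
rewrite [X in _ + X]big1 ?addr0; last by move=> j; rewrite -leqNgt; apply: f0.
rewrite -[RHS]big_filter; apply: perm_big; apply: uniq_perm.
- by rewrite filter_uniq // iota_uniq.
- by rewrite filter_uniq ?succs_uniq.
by move=> j; rewrite !mem_filter mem_index_iota andbC.
Qed.

(** * A positive Bezoutian *)

(** With a = 1 and b = -1 this is Narayana's cows sequence. Starting with two
    zeros makes the recurrence hold from the very first index, so that the last
    hubs, which lack an outgoing path, need no separate treatment. *)
Fixpoint delayed (A : comNzRingType) (a b : A) (n : nat) : A :=
  match n with
  | 0 | 1 => 0
  | 2 => 1
  | ((m.+1 as m1).+1 as m2).+1 => a * delayed a b m2 - b * delayed a b m
  end.
Arguments delayed {A} a b n : simpl never.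

Section Delayed.
Variables (A : comNzRingType) (a b : A).

Lemma delayed0 : delayed a b 0 = 0. Proof. by []. Qed.
Lemma delayed1 : delayed a b 1 = 0. Proof. by []. Qed.
Lemma delayed2 : delayed a b 2%N = 1. Proof. by []. Qed.
Lemma delayedS n :
  delayed a b n.+3 = a * delayed a b n.+2 - b * delayed a b n.
Proof. by []. Qed.
End Delayed.

Lemma ind3 (P : nat -> Prop) : P 0%N -> P 1%N -> P 2%N ->
  (forall n, P n -> P n.+1 -> P n.+2 -> P n.+3) -> forall n, P n.
Proof.
move=> P0 P1 P2 PS n; suff [] : [/\ P n, P n.+1 & P n.+2] by [].
by elim: n => // n [*]; split=> //; apply: PS.
Qed.

Lemma rmorph_delayed (A B : comNzRingType) (f : {rmorphism A -> B}) a b n :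
  f (delayed a b n) = delayed (f a) (f b) n.
Proof.
elim/ind3: n => [|||n IH0 _ IH2]; rewrite ?rmorph0 ?rmorph1 //.
by rewrite !delayedS rmorphB !rmorphM IH0 IH2.
Qed.

(** The sequences stand for a_j = q_j(w) q_j(v), s = w v and the quotients by
    w - v of
      b1_j : q_j(w) q_(j+1)(v) - q_(j+1)(w) q_j(v),
      b2_j : q_j(w) q_(j+2)(v) - q_(j+2)(w) q_j(v),
      e_j  : w q_j(w) q_(j+1)(v) - v q_(j+1)(w) q_j(v).
    Stating only their recurrences lets one argument serve for two distinct
    points and for the confluent case. Positivity is strict because
    b1_(j+4) is at least a_(j+2), which is positive for j <= 2, and at
    least s b1_(j+1) beyond. *)
Lemma bezoutian_rec_gt0 (K : numDomainType) (s : K) (a b1 b2 e : nat -> K) :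
    0 < s -> (forall j, 0 <= a j) -> 0 < a 2%N -> 0 < a 3%N -> 0 < a 4%N ->
    b1 0%N = 0 -> b1 1%N = 0 -> b1 2%N = 0 -> b2 0%N = 0 -> e 0%N = 0 -> e 1%N = 0 ->
    (forall j, b1 j.+3 = e j.+1 + s * b1 j) ->
    (forall j, b2 j.+1 = b1 j.+1 + e j) ->
    (forall j, e j.+2 = a j.+2 + s * b2 j) ->
  forall j, 0 < b1 j.+4.
Proof.
move=> s_gt0 a_ge0 a2 a3 a4 b10 b11 b12 b20 e0 e1 b1S b2S eS.
have s_ge0 := ltW s_gt0.
have all_ge0 j : [/\ 0 <= b1 j, 0 <= b1 j.+1 & 0 <= b1 j.+2] /\
    [/\ 0 <= b2 j, 0 <= e j & 0 <= e j.+1].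
  elim: j => [|j [[? ? ?] [? ? ?]]]; first by rewrite b10 b11 b12 b20 e0 e1.
  by rewrite b1S b2S eS !addr_ge0 ?mulr_ge0.
have b1_ge0 j : 0 <= b1 j by have [[]] := all_ge0 j.
have e_ge j : a j.+2 <= e j.+2.
  by rewrite eS lerDl mulr_ge0 //; have [_ []] := all_ge0 j.
have b1_gt j : 0 < a j.+2 -> 0 < b1 j.+4.
  move=> aj_gt0; rewrite b1S ltr_pwDl ?mulr_ge0 //.
  exact: lt_le_trans aj_gt0 (e_ge j).
elim/ind3 => [|||j b_gt0 _ _]; [exact: b1_gt|exact: b1_gt|exact: b1_gt|].
rewrite b1S ltr_wpDl ?mulr_gt0 //; exact: le_trans (a_ge0 _) (e_ge _).
Qed.

Lemma bezoutian_gt0 (K : numFieldType) (w v : K)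
    (u := delayed 1 w) (t := delayed 1 v) :
    0 < w * v -> w != v -> (forall j, 0 <= u j * t j) ->
  forall j, 0 < (u j.+4 * t j.+1.+4 - u j.+1.+4 * t j.+4) / (w - v).
Proof.
move=> wv_gt0 neq_wv ut_ge0; have nz : w - v != 0 by rewrite subr_eq0.
have uS j : u j.+3 = u j.+2 - w * u j by rewrite /u delayedS mul1r.
have tS j : t j.+3 = t j.+2 - v * t j by rewrite /t delayedS mul1r.
have u3 : u 3%N = 1 by rewrite uS /u delayed2 delayed0; ring.
have t3 : t 3%N = 1 by rewrite tS /t delayed2 delayed0; ring.
have u4 : u 4%N = 1 by rewrite uS u3 /u delayed1; ring.
have t4 : t 4%N = 1 by rewrite tS t3 /t delayed1; ring.
apply: (@bezoutian_rec_gt0 K (w * v) (fun j => u j * t j)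
  (fun j => (u j * t j.+1 - u j.+1 * t j) / (w - v))
  (fun j => (u j * t j.+2 - u j.+2 * t j) / (w - v))
  (fun j => (w * u j * t j.+1 - v * u j.+1 * t j) / (w - v))) => //;
  rewrite ?u3 ?t3 ?u4 ?t4 /u /t ?delayed0 ?delayed1 ?delayed2;
  try by rewrite ?mulr1 ?mul1r ?mulr0 ?mul0r ?subrr ?mul0r.
all: by move=> j; rewrite -?/(u _) -?/(t _) !uS ?tS; field.
Qed.

(** The limit of [bezoutian_gt0] as v tends to w. *)
Lemma wronskian_gt0 (K : numFieldType) (w : K) (q := delayed 1 'X) :
    0 < w * w -> (forall j, 0 <= (q j).[w] ^+ 2) ->
  forall j, 0 < (q j.+4)^`().[w] * (q j.+1.+4).[w]
    - (q j.+1.+4)^`().[w] * (q j.+4).[w].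
Proof.
move=> ww_gt0 q_ge0.
pose u j := (q j).[w]; pose u' j := (q j)^`().[w].
have qS j : q j.+3 = q j.+2 - 'X * q j by rewrite /q delayedS mul1r.
have uS j : u j.+3 = u j.+2 - w * u j by rewrite /u qS !hornerE.
have u'S j : u' j.+3 = u' j.+2 - u j - w * u' j.
  by rewrite /u' /u qS !derivE !hornerE; ring.
have u0 : u 0%N = 0 by rewrite /u /q delayed0 hornerE.
have u1 : u 1%N = 0 by rewrite /u /q delayed1 hornerE.
have u2 : u 2%N = 1 by rewrite /u /q delayed2 hornerE.
have u'0 : u' 0%N = 0 by rewrite /u' /q delayed0 derivE hornerE.
have u'1 : u' 1%N = 0 by rewrite /u' /q delayed1 derivE hornerE.
have u'2 : u' 2%N = 0 by rewrite /u' /q delayed2 derivE hornerE.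
have u3 : u 3%N = 1 by rewrite uS u2 u0; ring.
have u'3 : u' 3%N = 0 by rewrite u'S u'2 u'0 u0; ring.
have u4 : u 4%N = 1 by rewrite uS u3 u1; ring.
apply: (@bezoutian_rec_gt0 K (w * w) (fun j => u j ^+ 2)
  (fun j => u' j * u j.+1 - u' j.+1 * u j)
  (fun j => u' j * u j.+2 - u' j.+2 * u j)
  (fun j => u j * u j.+1 + w * (u' j * u j.+1 - u' j.+1 * u j))) => //;
  rewrite ?u3 ?u4 ?u2 ?u'2 ?u1 ?u'1 ?u0 ?u'0 ?u'3 ?expr1n //; try by ring.
all: by move=> j; rewrite !uS ?u'S; ring.
Qed.

Lemma root_delayed_simple (K : numClosedFieldType) (w : K) j (q := delayed 1 'X) :
  (* q_0, ..., q_4 are constant, and q_0 = q_1 = 0 *)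
  w != 0 -> root (q j.+1.+4) w -> ~~ root (q j.+1.+4)^`() w.
Proof.
move=> w_neq0 /rootP qw0.
have qE v i : (q i).[v] = delayed 1 v i.
  have := rmorph_delayed (horner_eval v) 1 'X i.
  by rewrite rmorph1 /= /horner_eval hornerX.
have qJ i : delayed 1 w^* i = (delayed 1 w i)^*.
  by rewrite (rmorph_delayed Num.conj) rmorph1.
have wwJ_gt0 : 0 < w * w^* by rewrite -normCK exprn_gt0 ?normr_gt0.
have qqJ_ge0 i : 0 <= delayed 1 w i * delayed 1 w^* i.
  by rewrite qJ -normCK exprn_ge0.
(* A nonreal root would be a common zero of q at w and at its conjugate, which
   annihilates the Bezoutian at this pair. *)
have wJ : w^* = w.
  apply/eqP/negPn/negP; rewrite eq_sym => neq_wwJ.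
  have := bezoutian_gt0 wwJ_gt0 neq_wwJ qqJ_ge0 j.
  by rewrite !qJ -!qE qw0 rmorph0 mulr0 mul0r subrr mul0r ltxx.
apply/negP=> /rootP q'w0.
have ww_gt0 : 0 < w * w by rewrite -{2}wJ.
have qq_ge0 i : 0 <= (q i).[w] ^+ 2 by rewrite expr2 qE -{2}wJ.
have := wronskian_gt0 ww_gt0 qq_ge0 j.
by rewrite -/q q'w0 qw0 mulr0 mul0r subrr ltxx.
Qed.

(** * The hub polynomials *)

(** Up to a power of X, the value at a_(r+2-j) of the solution of (X - A) x = 0
    that is 1 at a_r. *)
Definition hub_poly (K : fieldType) (d : nat) : nat -> {poly K} :=
  delayed 'X^d 'X^(2 * d - 2).

(** P_j(z) = z^(d (j - 2)) q_j(w) for w = z^-(d+2), and the derivative of this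
    identity, both with denominators cleared. *)
Lemma horner_hub_poly (K : fieldType) d (z w : K) j (P := hub_poly K d)
    (q := delayed 1 'X : nat -> {poly K}) : (0 < d)%N -> z ^+ (d + 2) * w = 1 ->
  z ^+ (2 * d) * (P j).[z] = z ^+ (d * j) * (q j).[w] /\
  z * (z ^+ (2 * d) * (P j)^`().[z]) =
  z ^+ (d * j) *
    ((d%:R * (j%:R - 2)) * (q j).[w] - (d + 2)%:R * w * (q j)^`().[w]).
Proof.
move=> d_gt0 zw; have z_neq0 : z != 0.
  by apply: contra_eq_neq zw => ->; rewrite addnS expr0n mul0r eq_sym oner_eq0.
have bE : z ^+ (2 * d - 2) = z ^+ (3 * d) * w.
  rewrite -[LHS]mulr1 -zw mulrA -exprD; congr (_ ^+ _ * _); lia.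
pose p j := (P j).[z]; pose p' j := z * (P j)^`().[z].
pose u j := (q j).[w]; pose u' j := (q j)^`().[w].
have zX k (f : {poly K}) : z * ('X^k * f)^`().[z] =
    z ^+ k * (k%:R * f.[z] + z * f^`().[z]).
  rewrite derivM derivXn hornerD !hornerM hornerMn !hornerXn.
  by case: k => [|k]; rewrite ?mulr0n /= ?exprS; ring.
have pS i : p i.+3 = z ^+ d * p i.+2 - z ^+ (3 * d) * w * p i.
  by rewrite /p /P /hub_poly delayedS !hornerE bE.
have p'S i : p' i.+3 = z ^+ d * (d%:R * p i.+2 + p' i.+2) -
    z ^+ (3 * d) * w * ((2 * d%:R - 2) * p i + p' i).
  rewrite /p' /p /P /hub_poly delayedS derivB hornerD hornerN mulrBr !zX bE.
  by rewrite natrB ?natrM //; lia.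
have uS i : u i.+3 = u i.+2 - w * u i.
  by rewrite /u /q delayedS mul1r !hornerE.
have u'S i : u' i.+3 = u' i.+2 - u i - w * u' i.
  by rewrite /u' /u /q delayedS mul1r !derivE !hornerE; ring.
suff : z ^+ (2 * d) * p j = z ^+ (d * j) * u j /\
    z ^+ (2 * d) * p' j = z ^+ (d * j) *
      ((d%:R * (j%:R - 2)) * u j - (d + 2)%:R * w * u' j).
  by rewrite /p' mulrCA.
elim/ind3: j => [|||j [IH0 IH0'] _ [IH2 IH2']].
- by rewrite /p' /u' /p /u /P /hub_poly /q !delayed0 !deriv0 !horner0; split; ring.
- by rewrite /p' /u' /p /u /P /hub_poly /q !delayed1 !deriv0 !horner0; split; ring.
- rewrite /p' /u' /p /u /P /hub_poly /q !delayed2 !derivC !horner0 !hornerC (mulnC d).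
  by split; ring.
have z2j : z ^+ (d * j.+2) = z ^+ (2 * d) * z ^+ (d * j).
  by rewrite -exprD !(mulnC d) -mulnDl.
have z3j : z ^+ (d * j.+3) = z ^+ (3 * d) * z ^+ (d * j).
  by rewrite -exprD !(mulnC d) -mulnDl.
rewrite pS p'S uS u'S z3j; rewrite z2j in IH2 IH2'.
have z3d : z ^+ (3 * d) = z ^+ d * z ^+ (2 * d) by rewrite -exprD -mulSn.
split.
  transitivity (z ^+ d * (z ^+ (2 * d) * p j.+2)
    - z ^+ (3 * d) * w * (z ^+ (2 * d) * p j)); first by ring.
  by rewrite IH2 IH0 z3d; ring.
transitivity (z ^+ d * (d%:R * (z ^+ (2 * d) * p j.+2)
      + z ^+ (2 * d) * p' j.+2) - z ^+ (3 * d) * w *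
      ((2 * d%:R - 2) * (z ^+ (2 * d) * p j) + z ^+ (2 * d) * p' j)).
  by ring.
by rewrite IH2 IH2' IH0 IH0' z3d; ring.
Qed.

Lemma root_hub_poly_simple (K : numClosedFieldType) d (z : K) j
    (P := hub_poly K d) :
  (0 < d)%N -> z != 0 -> root (P j.+1.+4) z -> ~~ root (P j.+1.+4)^`() z.
Proof.
move=> d_gt0 z_neq0 Pz0; set n := j.+1.+4 in Pz0 *; pose w := z ^- (d + 2).
have zw : z ^+ (d + 2) * w = 1 by rewrite divff ?expf_neq0.
have w_neq0 : w != 0 by rewrite invr_neq0 ?expf_neq0.
have [Pz P'z] := horner_hub_poly n d_gt0 zw.
have qw0 : (delayed 1 'X n).[w] = 0.
  apply/eqP; rewrite -(mulrI_eq0 _ (mulfI (expf_neq0 (d * n) z_neq0))) -Pz.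
  by rewrite (rootP Pz0) mulr0.
have := root_delayed_simple w_neq0 (introT rootP qw0).
apply: contra => /rootP P'z0; apply/rootP/eqP.
move/eqP: P'z; rewrite P'z0 qw0 !mulr0 sub0r eq_sym mulf_eq0 oppr_eq0.
rewrite expf_eq0 (negPf z_neq0) andbF !mulf_eq0 (negPf w_neq0) pnatr_eq0.
by rewrite addn2.
Qed.

(** * The characteristic polynomial *)

Lemma det_mul_cofactor (A : comPzRingType) n (M : 'M[A]_n) (x : 'cV_n) c i j :
  M *m x = c *: delta_mx i 0 -> \det M * x j 0 = cofactor M i j * c.
Proof.
move=> Mx; have /matrixP/(_ j 0) : \adj M *m (M *m x) = \det M *: x.
  by rewrite mulmxA mul_adj_mx mul_scalar_mx.
by rewrite Mx -scalemxAr -colE !mxE mulrC => ->.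
Qed.

(** The cofactor is the determinant of M with row i replaced by the j-th unit
    row, and the hypothesis says that this matrix has trivial kernel. *)
Lemma cofactor_neq0 (F : fieldType) n (M : 'M[F]_n) i j :
    (forall v : 'cV_n, v j 0 = 0 ->
       (forall k, k != i -> (M *m v) k 0 = 0) -> v = 0) ->
  cofactor M i j != 0.
Proof.
move=> M_inj; pose B := \matrix_k (if k == i then delta_mx 0 j else row k M).
have rowB k : row k B = if k == i then delta_mx 0 j else row k M by rewrite rowK.
have -> : cofactor M i j = \det B.
  rewrite (expand_det_row B i) (bigD1 j) //= big1 ?addr0 => [|k j'k]; last first.
    by rewrite !mxE eqxx !mxE (negPf j'k) andbF mul0r.
  rewrite !mxE eqxx !mxE !eqxx mul1r /cofactor; congr (_ * \det _).
  apply/matrixP=> a b; rewrite !mxE; case: eqP => [/eqP|_]; last by rewrite mxE.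
  by rewrite eq_sym (negPf (neq_lift _ _)).
rewrite -det_tr; apply/det0P=> -[v v_neq0 vB].
have Bv : B *m v^T = 0 by apply: trmx_inj; rewrite trmx_mul trmxK trmx0.
case/eqP: v_neq0; apply: trmx_inj; rewrite trmx0; apply: M_inj => [|k k'i].
  have := congr1 (fun u : 'cV_n => u i 0) Bv.
  have -> : (B *m v^T) i 0 = (row i B *m v^T) 0 0 by rewrite -row_mul [RHS]mxE.
  by rewrite rowB eqxx -rowE !mxE.
have := congr1 (fun u : 'cV_n => u k 0) Bv.
have -> : (B *m v^T) k 0 = (row k B *m v^T) 0 0 by rewrite -row_mul [RHS]mxE.
by rewrite rowB (negPf k'i) -row_mul [RHS]mxE [in X in X -> _]mxE.
Qed.

Section TestVector.
Variables (K : fieldType) (d r : nat).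
Hypotheses (d_gt0 : (0 < d)%N) (r_gt0 : (0 < r)%N).
Local Notation P := (hub_poly K d).

(** The vertex i > 0 is an inner vertex of the path that ends at the hub
    a_(k+1) = k.+1 * d + 1, or that hub itself; the exponent grows by 1 along each
    edge of the path, since x_(i+1) = X x_i at an inner vertex. *)
Definition test_vec (i : nat) : {poly K} :=
  if i == 0%N then 'X^d * P (r + 2)
  else let k := ((i - 2) %/ d)%N in 'X^(d + i - k.+2) * P (r + 1 - k).

Lemma test_vecE k i : (0 < i)%N -> (k * d <= i - 2 < k.+1 * d)%N ->
  test_vec i = 'X^(d + i - k.+2) * P (r + 1 - k).
Proof.
rewrite /test_vec -ltn_divLR // -leq_divRL // ltnS -eqn_leq.
by case: i => // i _ /eqP <-.
Qed.

Lemma test_vec_hub k : (0 < k)%N ->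
  test_vec (k * d + 1) = 'X^(k.+1 * d - k) * P (r + 2 - k).
Proof.
case: k => // k _; rewrite (@test_vecE k); first last.
- by rewrite !mulSn; lia.
- by lia.
rewrite !mulSn.
by congr ('X^_ * P _); lia.
Qed.

Lemma test_vec_hubS k : 
  test_vec (k * d + 2) = 'X^(k.+1 * d - k) * P (r + 1 - k).
Proof.
rewrite (@test_vecE k); first last.
- by rewrite !mulSn; lia.
- by lia.
rewrite !mulSn.
by congr ('X^_ * P _); lia.
Qed.

(** Beyond the last vertex k >= r, so that the index of P is at most 1. *)
Lemma test_vec0 j : (r * d + 2 <= j)%N -> test_vec j = 0.
Proof.
move=> j_ge; rewrite /test_vec ifF /=; last by lia.
have : (r <= (j - 2) %/ d)%N by rewrite leq_divRL //; lia.
set k := (_ %/ d)%N => k_ge.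
have [->|->] : (r + 1 - k = 0)%N \/ (r + 1 - k = 1)%N by lia.
  by rewrite /hub_poly delayed0 mulr0.
by rewrite /hub_poly delayed1 mulr0.
Qed.

Lemma test_vec_row i : (0 < i)%N -> (i < r * d + 2)%N ->
  'X * test_vec i = \sum_(j <- succs d i) test_vec j.
Proof.
move=> i_gt0 i_lt; case: succsP => // [i0|k k_gt0 iE|_ i_nhub]; first by lia.
  have k_le : (k <= r)%N by rewrite -(leq_pmul2r d_gt0); lia.
  rewrite big_cons big_seq1.
  (* The previous hub; at k = 1 it is the root, which obeys the same formula. *)
  have -> : test_vec (if k == 1%N then 0%N else ((k - 1) * d + 1)%N) =
      'X^(k * d - k.-1) * P (r - k).+3.
    case: k k_gt0 k_le {iE} => [|[|k]] // _ k_le.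
      by rewrite /test_vec /=; congr ('X^_ * P _); lia.
    by rewrite /= subn1 test_vec_hub //; congr ('X^_ * P _); lia.
  rewrite iE test_vec_hub // test_vec_hubS /hub_poly.
  have -> : (r + 2 - k = (r - k).+2)%N by lia.
  have -> : (r + 1 - (k + 1) = r - k)%N by lia.
  rewrite delayedS mulrBr !mulrA -exprS -!exprD.
  have kd : (k <= k * d)%N by rewrite leq_pmulr.
  rewrite addn1 !mulSn.
  have -> : (k * d - k.-1 + d = (d + k * d - k).+1)%N by lia.
  have -> : (k * d - k.-1 + (2 * d - 2) = d + (d + k * d) - k.+1)%N by lia.
  by rewrite subrK.
rewrite big_seq1 /test_vec ifF; last by lia.
rewrite ifF; last by lia.
have -> : ((i + 1 - 2) %/ d = (i - 2) %/ d)%N.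
  case: (leqP i 1) => i_le; first by rewrite !divn_small //; lia.
  have iE := divn_eq (i - 2) d; have s_lt := ltn_pmod (i - 2) d_gt0.
  move: iE s_lt; set k := (_ %/ d)%N; set s := (_ %% d)%N => iE s_lt.
  have -> : (i + 1 - 2 = k * d + s.+1)%N by lia.
  rewrite divnMDl // divn_small ?addn0 // ltn_neqAle s_lt andbT.
  by apply/eqP=> sE; apply: (i_nhub k.+1) => //; rewrite mulSn; lia.
rewrite mulrA -exprS /=; congr ('X^_ * _).
by have := leq_div (i - 2) d; lia.
Qed.

(** Two more steps of the recurrence: the path from the root to a_2 accounts
    for the first, and the path from the root to a_1 for the second. *)
Lemma test_vec_row0 :
  'X^(d - 1) * ('X * test_vec 0 - \sum_(j <- succs d 0) test_vec j) = P r.+4.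
Proof.
have -> : succs d 0 = [:: 1; d + 2]%N by [].
rewrite big_cons big_seq1 -{2}(mul1n d) test_vec_hubS.
rewrite (@test_vecE 0 1) // ?mul1n // /test_vec eqxx /hub_poly.
have -> : (d + 1 - 2 = d - 1)%N by lia.
have -> : (r + 1 - 0 = r.+1)%N by lia.
rewrite addnK addn2 [delayed _ _ r.+4]delayedS [delayed _ _ r.+3]delayedS.
have [e ->] : exists e, d = e.+1 by exists d.-1; lia.
have -> : (2 * e.+1 - 1 = e + e.+1)%N by lia.
have -> : (2 * e.+1 - 2 = e + e)%N by lia.
by rewrite subn1 /= !exprD !exprS; ring.
Qed.

Lemma test_vec_last : test_vec (r * d + 1) = 'X^(r.+1 * d - r).
Proof. by rewrite test_vec_hub // addnC addnK /hub_poly delayed2 mulr1. Qed.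

(** Downward induction: an inner vertex is determined by its only successor,
    and a hub by the equation of the next hub, which has it as a successor. *)
Lemma kernel_trivial (z : K) (f : nat -> K) : z != 0 ->
    (forall j, (r * d + 1 <= j)%N -> f j = 0) ->
    (forall i, (0 < i)%N -> (i < r * d + 2)%N ->
       z * f i = \sum_(j <- succs d i) f j) ->
  forall i, f i = 0.
Proof.
move=> z_neq0 f_top f_row.
suff f0 m : forall i, (r * d + 1 <= i + m)%N -> f i = 0.
  by move=> i; apply: (f0 (r * d + 1)%N); rewrite leq_addl.
elim: m => [|m IH] i; first by rewrite addn0; apply: f_top.
have [/IH //|] := leqP (r * d + 1)%N (i + m); move=> i_lt i_ge.
have f_gt j : (i < j)%N -> f j = 0 by move=> i_lt_j; apply: IH; lia.
have hub k : (0 < k <= r)%N ->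
    i = (if k == 1 then 0 else (k - 1) * d + 1)%N -> f i = 0.
  move=> /andP[k_gt0 k_le] iE.
  have kd : (k * d <= r * d)%N by rewrite leq_mul2r k_le orbT.
  have d_le : (d <= k * d)%N by rewrite leq_pmull.
  have k1d : ((k - 1) * d = k * d - d)%N by rewrite mulnBl mul1n.
  have ik : (i < k * d + 1)%N by rewrite iE; case: eqP => _; lia.
  have := f_row (k * d + 1)%N; rewrite succs_hub // big_cons big_seq1 -iE.
  rewrite (f_gt (k * d + 1)%N) // (f_gt ((k + 1) * d + 2)%N); last first.
    by rewrite mulnDl; lia.
  by rewrite mulr0 addr0 => <- //; lia.
case: (posnP i) => [i0|i_gt0]; first by apply: (hub 1%N).
have := f_row i i_gt0; case: succsP => // [i0|k k_gt0 iE|_ _]; first by lia.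
  move=> _; apply: (hub k.+1); last by rewrite subn1 /= eqSS (gtn_eqF k_gt0).
  by rewrite /= -(ltn_pmul2r d_gt0); lia.
rewrite big_seq1 (f_gt (i + 1)%N) ?addn1 // => /(_ ltac:(lia)) /eqP.
by rewrite mulf_eq0 (negPf z_neq0) => /eqP.
Qed.
End TestVector.

(** g is the cofactor of X - A at the root and the last hub. *)
Lemma char_poly_cofactor (K : fieldType) d r :
    (0 < d)%N -> (0 < r)%N ->
  exists m (g : {poly K}), [/\
    char_poly (adjacency K (d + 2) r) * 'X^m = g * hub_poly K d r.+4
    & forall z, z != 0 -> ~~ root g z].
Proof.
move=> d_gt0 r_gt0; set A := adjacency K _ r.
have NE : nvertices (d + 2) r = (r * d + 2)%N by rewrite /nvertices; lia.
have first_lt : (0 < nvertices (d + 2) r)%N by rewrite NE; lia.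
have last_lt : (r * d + 1 < nvertices (d + 2) r)%N by rewrite NE; lia.
pose i0 := Ordinal first_lt; pose j0 := Ordinal last_lt.
have lt_N (i : 'I_(nvertices (d + 2) r)) : (i < r * d + 2)%N by rewrite -NE.
have sumA (B : nzRingType) (f : nat -> B) i : (i < r * d + 2)%N ->
    (forall j, (r * d + 2 <= j)%N -> f j = 0) ->
    \sum_j (Gamma (d + 2) r i.+1 (j : 'I_(nvertices (d + 2) r)).+1)%:R * f j =
    \sum_(j <- succs d i) f j.
  move=> i_lt f0; rewrite -(@sum_succs B d r i f) //.
  rewrite -(big_mkord predT (fun j => (Gamma (d + 2) r i.+1 j.+1)%:R * f j)).
  by rewrite NE big_mkord.
pose x := \col_(i < nvertices (d + 2) r) test_vec K d r i.
pose c := 'X * test_vec K d r 0 - \sum_(j <- succs d 0) test_vec K d r j.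
have Mx : char_poly_mx A *m x = c *: delta_mx i0 0.
  apply/colP=> i; rewrite mulmxBl mul_scalar_mx !mxE eqxx andbT.
  under eq_bigr => j _ do rewrite !mxE rmorph_nat.
  rewrite sumA //; last exact: test_vec0.
  case: eqP => [->|/eqP i'0]; first by rewrite mulr1.
  rewrite test_vec_row ?subrr ?mulr0 //.
  by rewrite lt0n; apply: contra i'0 => /eqP i_0; apply/eqP/val_inj.
have := det_mul_cofactor j0 Mx; rewrite mxE test_vec_last //.
set g := cofactor _ _ _.
move=> gE; exists (r.+1 * d - r + (d - 1))%N, g; split=> [|z z_neq0].
  by rewrite exprD mulrA gE -test_vec_row0 // -/c mulrAC mulrA.
rewrite /root -/(horner_eval z g) -cofactor_map_mx.
apply: cofactor_neq0 => v v_last v_row.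
pose f k := if insub k is Some i then v i 0 else 0.
have fE (i : 'I_(nvertices (d + 2) r)) : f i = v i 0 by rewrite /f valK.
have f_top j : (r * d + 2 <= j)%N -> f j = 0.
  by move=> j_ge; rewrite /f insubF // NE ltnNge j_ge.
apply/colP=> i; rewrite mxE -fE.
apply: (kernel_trivial d_gt0 r_gt0 z_neq0) => [j|k k_gt0 k_lt].
  rewrite leq_eqVlt => /orP[/eqP <-|]; first by rewrite -v_last -fE.
  by rewrite -addnS; apply: f_top.
have k_ltN := k_lt; rewrite -NE in k_ltN; have := v_row (Ordinal k_ltN).
rewrite -val_eqE -lt0n => /(_ k_gt0); rewrite mxE => rowk.
have charE j : (char_poly_mx A ^ horner_eval z)%sesqui (Ordinal k_ltN) j * v j 0 =
    z *+ (k == j) * f j - (Gamma (d + 2) r k.+1 j.+1)%:R * f j.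
  rewrite !mxE /horner_eval hornerD hornerN hornerMn hornerX hornerC mulrBl.
  by rewrite -fE.
move: rowk; rewrite (eq_bigr _ (fun j _ => charE j)) sumrB sumA //.
rewrite (bigD1 (Ordinal k_ltN)) //= eqxx mulr1n big1 ?addr0 => [/subr0_eq //|j j'k].
rewrite -[k]/(val (Ordinal k_ltN)) val_eqE eq_sym (negPf j'k).
by rewrite mulr0n mul0r.
Qed.

Lemma mup_simple_root (F : fieldType) (p : {poly F}) z :
  root p z -> ~~ root p^`() z -> mup z p = 1%N.
Proof.
move=> pz p'z; have p_neq0 : p != 0.
  by apply: contra p'z => /eqP->; rewrite deriv0 root0.
apply/eqP; rewrite eqn_leq -ltnS mup_ltn // mup_geq // expr1.
rewrite dvdp_XsubCl pz andbT.
apply: contra p'z => /dvdpP[q ->]; rewrite expr2 mulrA derivM rootE.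
by rewrite hornerD !hornerM hornerXsubC subrr !(mulr0, mul0r) addr0.
Qed.

Theorem corollary3p5 (R : realType) (n r : nat) (hn : (3 <= n)%N)
    (hr : (1 <= r)%N) (z : complex R) :
  eigenvalue (adjacency (complex R) n r) z -> z != 0 ->
  mup z (char_poly (adjacency (complex R) n r)) = 1%N.
Proof.
have [d nE] : exists d, n = (d + 2)%N by exists (n - 2)%N; lia.
subst n; have d_gt0 : (0 < d)%N by lia.
rewrite eigenvalue_root_char => chi0 z_neq0.
have [m [g [chiE g_neq0]]] := char_poly_cofactor (complex R) d_gt0 hr.
set chi := char_poly _ in chi0 chiE *.
apply: mup_simple_root => //.
have Pz : root (hub_poly _ d r.+4) z.
  have := congr1 (root^~ z) chiE.
  by rewrite !rootM (negPf (g_neq0 _ z_neq0)) chi0 /= => <-.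
have P'z : ~~ root (hub_poly _ d r.+4)^`() z.
  by case: r hr Pz {chi chi0 chiE} => // r _; apply: root_hub_poly_simple.
apply: contra P'z => chi'0.
have := congr1 (fun p : {poly _} => p^`().[z]) chiE.
rewrite !derivM !hornerD !hornerM (rootP chi0) (rootP Pz) (rootP chi'0).
rewrite !(mul0r, mulr0, add0r) => /esym/eqP.
by rewrite mulf_eq0 -!rootE (negPf (g_neq0 _ z_neq0)).
Qed.
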